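(* Let $\phi_1,\phi_2:\mathbb{R}_+\to\mathbb{R}_+$, $\phi_1(t)=t^p$ and $\phi_2(t)=t^q$, where $p,q>0$ and $p\neq q$. Given $L\in\mathcal{L}$, the Cauchy mean reversiblization $C_{p,q}$ is $\pi$-reversible, that is, $C_{p,q}\in\mathcal{L}(\pi)$, where $C_{p,q}:=F_g$ with balancing function $$g(t)=\left(\frac{\phi_1'}{\phi_2'}\right)^{-1}\!\left(\frac{\phi_1(t)-\phi_1(1)}{\phi_2(t)-\phi_2(1)}\right)=\left(\frac{q(t^p-1)}{p(t^q-1)}\right)^{1/(p-q)}.$$
   Context: $\mathcal{X}$ is a finite set and $\pi$ is a fixed probability distribution on $\mathcal{X}$ with $\pi(x)>0$ for all $x$. $\mathcal{L}$ is the set of Markov infinitesimal generators on $\mathcal{X}$, i.e. $\mathcal{X}\times\mathcal{X}$ real matrices with non-negative off-diagonal entries and all row sums zero. $\mathcal{L}(\pi)\subseteq\mathcal{L}$ is the set of $\pi$-reversible generators, i.e. those $M$ with $\pi(x)M(x,y)=\pi(y)M(y,x)$ for all $x,y$. The $\pi$-dual $L_\pi$ of $L\in\mathcal{L}$ is the generator with off-diagonal entries $L_\pi(x,y)=\frac{\pi(y)}{\pi(x)}L(y,x)$, $x\neq y$, and diagonal entries such that all row sums are zero. A balancing function is $g:\mathbb{R}_+\to\mathbb{R}_+$ with $g(t)=tg(1/t)$ for $t>0$. Given $L\in\mathcal{L}$ and such $g$, $F_g$ is defined for $x\ne y$ by $$F_g(x,y):=\begin{cases}L(x,y),&L(x,y)=L_\pi(x,y),\\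 g(0)L_\pi(x,y),&L(x,y)=0\text{ and }L_\pi(x,y)>0,\\ g\!\left(\frac{L_\pi(x,y)}{L(x,y)}\right)L(x,y),&\text{otherwise},\end{cases}$$ with diagonal entries such that all row sums are zero. (The value $g(1)$ is not used in this definition.) *)

(* Defs.v *)
From HB Require Import structures.
From mathcomp Require Import all_boot all_order all_algebra.
From mathcomp Require Import all_classical all_reals all_analysis.
Set Implicit Arguments.
Unset Strict Implicit.
Unset Printing Implicit Defensive.
Import Order.TTheory GRing.Theory Num.Theory.
Import numFieldNormedType.Exports.
Local Open Scope classical_set_scope.
Local Open Scope ring_scope.

Section Generators.
Context {R : realType} {X : finType}.
Implicit Types (mu : X -> R) (L M : X -> X -> R) (g : R -> R).

Definition positive_distribution mu : Prop :=
  (forall x, 0 < mu x) /\ \sum_(x : X) mu x = 1.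

Definition generator L : Prop :=
  (forall x y, x != y -> 0 <= L x y) /\ (forall x, \sum_(y : X) L x y = 0).

Definition reversible_generator mu M : Prop :=
  generator M /\ (forall x y, mu x * M x y = mu y * M y x).

(* Only the off-diagonal entries of [A] are used. *)
Definition with_zero_row_sums (A : X -> X -> R) : X -> X -> R :=
  fun x y => if x == y then - \sum_(z | z != x) A x z else A x y.

Definition dual mu L : X -> X -> R :=
  with_zero_row_sums (fun x y => mu y / mu x * L y x).

Definition balanced_generator mu g L : X -> X -> R :=
  with_zero_row_sums (fun x y =>
    let Lxy := L x y in
    let Dxy := dual mu L x y in
    if Lxy == Dxy then Lxy
    else if (Lxy == 0) && (0 < Dxy) then g 0 * Dxy
    else g (Dxy / Lxy) * Lxy).

End Generators.

Section Balancing.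
Context {R : realType}.
Implicit Types (g phi : R -> R).

(* Functions from [0, +oo[ to itself are total functions on [R] of which only
   the values on [0, +oo[ matter. *)
Definition balancing_function g : Prop :=
  (forall t, 0 <= t -> 0 <= g t) /\ (forall t, 0 < t -> g t = t * g t^-1).

Definition derivative_ratio phi1 phi2 : R -> R :=
  fun s => derive1 phi1 s / derive1 phi2 s.

(* The quotient is 0 / 0 at t = 1; the value 1 there is the usual convention
   for a mean of two equal numbers. The inverse is that of the derivative
   ratio seen as a function on ]0, +oo[. *)
Definition cauchy_function phi1 phi2 : R -> R := fun t =>
  if t == 1 then 1 else
  pinv [set s : R | 0 < s] (derivative_ratio phi1 phi2)
    ((phi1 t - phi1 1) / (phi2 t - phi2 1)).

Definition cauchy_power_function (p q : R) : R -> R :=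
  cauchy_function (fun t => t `^ p) (fun t => t `^ q).

Definition cauchy_reversiblization {X : finType} (mu : X -> R) (p q : R)
    (L : X -> X -> R) : X -> X -> R :=
  balanced_generator mu (cauchy_power_function p q) L.

End Balancing.

(* Main.v *)
Require Import Defs.
From HB Require Import structures.
From mathcomp Require Import all_boot all_order all_algebra.
From mathcomp Require Import all_classical all_reals all_analysis.
From mathcomp Require Import ring.
Import Order.TTheory GRing.Theory Num.Theory.
Import numFieldNormedType.Exports.
Local Open Scope classical_set_scope.
Local Open Scope ring_scope.

(** The off-diagonal rate F_g(x, y) depends only on the pair of nonnegative
    numbers a = L(x, y) and b = L_pi(x, y); write it as a function G(a, b).
    This G is positively homogeneous of degree one, and the identity
    g(t) = t g(1/t) says exactly that G is symmetric. By homogeneity,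
    pi(x) F_g(x, y) = G(pi(x) L(x, y), pi(x) L_pi(x, y)), and here
    pi(x) L_pi(x, y) = pi(y) L(y, x): the right-hand side is G evaluated at the
    probability flows from x to y and from y to x, so that symmetry of G is
    detailed balance. Thus F_g is pi-reversible for every balancing function g
    ([balanced_generator_reversible]).

    It remains to analyse the Cauchy function of two powers. The ratio of the
    derivatives is s |-> (p / q) s^(p - q), a bijection of the positive half
    line whose inverse is v |-> ((q / p) v)^(1 / (p - q)); since t^p - 1 and
    t^q - 1 have the same sign, this inverse may be applied to their quotient,
    which yields the closed form. Finally, replacing t by 1 / t multiplies
    (t^p - 1) / (t^q - 1) by t^(q - p), hence the function by 1 / t. *)

(** * Reversibility of balanced generators *)

(** The common shape of all off-diagonal entries of [balanced_generator]: a
    homogeneous function of the rate [a] and of the dual rate [b]. *)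
Definition balanced_rate {R : realType} (g : R -> R) (a b : R) : R :=
  if a == b then a
  else if (a == 0) && (0 < b) then g 0 * b
  else g (b / a) * a.

Section BalancedRate.
Context {R : realType}.
Implicit Types (g : R -> R) (a b c : R).

Lemma balanced_rate_ge0 g a b : balancing_function g ->
  0 <= a -> 0 <= b -> 0 <= balanced_rate g a b.
Proof.
move=> [g0 _] a0 b0; rewrite /balanced_rate.
by do 2![case: ifP => // _]; rewrite mulr_ge0 ?g0 ?divr_ge0.
Qed.

Lemma balanced_rateZ g a b c : 0 < c ->
  balanced_rate g (c * a) (c * b) = c * balanced_rate g a b.
Proof.
move=> c0; have cn0 : c != 0 by rewrite gt_eqF.
rewrite /balanced_rate (inj_eq (mulfI cn0)) mulf_eq0 (negPf cn0) /= pmulr_rgt0//.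
case: ifP => // _; case: ifP => _; first by rewrite mulrCA.
by rewrite -mulf_div divff// mul1r mulrCA.
Qed.

(** When both rates are positive this is the identity g(t) = t g(1/t) at
    t = b / a. When one of them vanishes it reads g(0) b = g(0 / b) b, which is
    why the definition of the generator singles out the case a = 0 < b. *)
Lemma balanced_rateC g a b : balancing_function g ->
  0 <= a -> 0 <= b -> balanced_rate g a b = balanced_rate g b a.
Proof.
move=> [_ gV]; rewrite /balanced_rate (eq_sym b a).
case: eqVneq => [->//|ab].
rewrite !le0r => /orP[/eqP a0|a0] /orP[/eqP b0|b0].
- by rewrite a0 b0 eqxx in ab.
- by rewrite a0 eqxx b0 ltxx andbF mul0r.
- by rewrite b0 eqxx a0 ltxx andbF mul0r.
- rewrite !gt_eqF//= gV ?divr_gt0// invf_div.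
  by rewrite mulrAC divfK ?gt_eqF// mulrC.
Qed.

End BalancedRate.

Section Reversibility.
Context {R : realType} {X : finType}.
Implicit Types (mu : X -> R) (L A : X -> X -> R) (g : R -> R).

Lemma sum_with_zero_row_sums A x : \sum_y with_zero_row_sums A x y = 0.
Proof.
rewrite (bigD1 x)//= {1}/with_zero_row_sums eqxx.
rewrite (eq_bigr (fun z => A x z)) ?addNr// => z zx.
by rewrite /with_zero_row_sums eq_sym (negPf zx).
Qed.

Lemma reversible_with_zero_row_sums mu A :
  (forall x y, x != y -> 0 <= A x y) ->
  (forall x y, x != y -> mu x * A x y = mu y * A y x) ->
  reversible_generator mu (with_zero_row_sums A).
Proof.
move=> A0 Asym; split; first split.
- by move=> x y xy; rewrite /with_zero_row_sums (negPf xy) A0.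
- exact: sum_with_zero_row_sums.
- move=> x y; have [->//|xy] := eqVneq x y.
  by rewrite /with_zero_row_sums [y == x]eq_sym (negPf xy) Asym.
Qed.

Lemma dual_offdiag mu L x y : x != y -> dual mu L x y = mu y / mu x * L y x.
Proof. by move=> xy; rewrite /dual /with_zero_row_sums (negPf xy). Qed.

Lemma balanced_generator_reversible mu g L :
  positive_distribution mu -> balancing_function g -> generator L ->
  reversible_generator mu (balanced_generator mu g L).
Proof.
move=> [mu0 _] gbal [L0 _].
have dual0 x y : x != y -> 0 <= dual mu L x y.
  move=> xy; rewrite dual_offdiag// mulr_ge0 ?L0 ?divr_ge0 ?ltW//.
  by rewrite eq_sym.
(* the dual generator reverses the probability flow *)
have flow x y : x != y -> mu x * dual mu L x y = mu y * L y x.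
  by move=> xy; rewrite dual_offdiag// mulrA mulrCA divff ?mulr1// gt_eqF.
apply: reversible_with_zero_row_sums => x y xy.
  exact: balanced_rate_ge0 gbal (L0 _ _ xy) (dual0 _ _ xy).
have yx : y != x by rewrite eq_sym.
rewrite -!/(balanced_rate _ _ _) -!balanced_rateZ// !flow//.
by rewrite balanced_rateC// mulr_ge0 ?L0 ?ltW.
Qed.

End Reversibility.

(** * The Cauchy function of two powers *)

Section CauchyPower.
Context {R : realType} (p q : R).
Hypotheses (p0 : 0 < p) (q0 : 0 < q) (pq : p != q).
Implicit Types s t v : R.

Local Notation ratio :=
  (derivative_ratio (fun t : R => t `^ p) (fun t : R => t `^ q)).
Local Notation ratio_inv := (fun v : R => (q / p * v) `^ (1 / (p - q))).

Let p_neq0 : p != 0. Proof. by rewrite gt_eqF. Qed.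
Let q_neq0 : q != 0. Proof. by rewrite gt_eqF. Qed.
Let pq_neq0 : p - q != 0. Proof. by rewrite subr_eq0. Qed.

Lemma derivative_ratio_powR s : 0 < s -> ratio s = p / q * s `^ (p - q).
Proof.
move=> s0; rewrite /derivative_ratio !derive1E.
rewrite (@derive_val _ _ _ _ _ _ _ (is_derive1_powR p s0)).
rewrite (@derive_val _ _ _ _ _ _ _ (is_derive1_powR q s0)).
rewrite -mulf_div -powRB; last by rewrite (gt_eqF s0) implybT.
by congr (_ * _ `^ _); ring.
Qed.

Lemma derivative_ratio_powR_gt0 s : 0 < s -> 0 < ratio s.
Proof.
by move=> s0; rewrite derivative_ratio_powR// mulr_gt0 ?divr_gt0 ?powR_gt0.
Qed.

Lemma derivative_ratio_powRK s : 0 < s -> ratio_inv (ratio s) = s.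
Proof.
move=> s0 /=; rewrite derivative_ratio_powR// mulrA.
rewrite div1r mulf_div [q * p]mulrC divff ?mulf_neq0// mul1r.
by rewrite -powRrM divff// powRr1// ltW.
Qed.

Lemma derivative_ratio_powRKV v : 0 < v -> ratio (ratio_inv v) = v.
Proof.
move=> v0 /=; have w0 : 0 < q / p * v by rewrite mulr_gt0 ?divr_gt0.
rewrite derivative_ratio_powR ?powR_gt0// -powRrM div1r mulVf//.
rewrite powRr1 ?ltW// mulrA mulf_div [q * p]mulrC divff ?mul1r//.
by rewrite mulf_neq0.
Qed.

Lemma derivative_ratio_powR_inj : {in [set s : R | 0 < s] &, injective ratio}.
Proof.
move=> s t /set_mem /= s0 /set_mem /= t0 st.
by rewrite -(derivative_ratio_powRK s s0) st derivative_ratio_powRK.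
Qed.

Lemma derivative_ratio_powR_bij :
  set_bij [set s : R | 0 < s] [set s : R | 0 < s] ratio.
Proof.
split; last 2 [exact: derivative_ratio_powR_inj].
- by move=> s /= s0; exact: derivative_ratio_powR_gt0.
- move=> v /= v0; exists (ratio_inv v); last exact: derivative_ratio_powRKV.
  by rewrite /= powR_gt0// mulr_gt0 ?divr_gt0.
Qed.

Lemma pinv_derivative_ratio_powR v : 0 < v ->
  pinv [set s : R | 0 < s] ratio v = ratio_inv v.
Proof.
move=> v0; rewrite -{1}(derivative_ratio_powRKV v v0).
rewrite pinvKV//; first exact: derivative_ratio_powR_inj.
by rewrite inE /= powR_gt0// mulr_gt0 ?divr_gt0.
Qed.

(** [t `^ r] is increasing in [t], so both differences have the sign of
    [t - 1]. *)
Lemma powR_sub1_div_gt0 t : 0 <= t -> t != 1 ->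
  0 < (t `^ p - 1) / (t `^ q - 1).
Proof.
move=> t0; rewrite neq_lt => /orP[t1|t1].
- rewrite -divrNN divr_gt0// oppr_gt0 subr_lt0.
  + by rewrite -[ltRHS](congr1 (fun f => f p) (powR1 R)) gt0_ltr_powR// nnegrE.
  + by rewrite -[ltRHS](congr1 (fun f => f q) (powR1 R)) gt0_ltr_powR// nnegrE.
- rewrite divr_gt0// subr_gt0.
  + by rewrite -[ltLHS](congr1 (fun f => f p) (powR1 R)) gt0_ltr_powR// nnegrE.
  + by rewrite -[ltLHS](congr1 (fun f => f q) (powR1 R)) gt0_ltr_powR// nnegrE.
Qed.

Lemma cauchy_power_functionE t : 0 <= t -> t != 1 ->
  cauchy_power_function p q t =
  (q * (t `^ p - 1) / (p * (t `^ q - 1))) `^ (1 / (p - q)).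
Proof.
move=> t0 t1; rewrite /cauchy_power_function /cauchy_function (negPf t1).
rewrite powR1 pinv_derivative_ratio_powR; last exact: powR_sub1_div_gt0.
by rewrite /= mulf_div.
Qed.

(** Multiplying t^-p - 1 by t^p reverses the sign of t^p - 1, and likewise for
    q; the two signs cancel. The remaining factor t^(q - p) is what the exponent
    1 / (p - q) of the Cauchy function turns into 1 / t. *)
Lemma powR_sub1_divV t : 0 < t -> t != 1 ->
  (t^-1 `^ p - 1) / (t^-1 `^ q - 1) =
  (t `^ p - 1) / (t `^ q - 1) * t `^ (q - p).
Proof.
move=> t0 t1; rewrite -(powR_inv1 (ltW t0)) !(powRAC t (-1)) !powR_inv1 ?powR_ge0//.
rewrite powRB ?(gt_eqF t0) ?implybT//.
have tp0 : t `^ p != 0 by rewrite gt_eqF ?powR_gt0.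
have tq0 : t `^ q != 0 by rewrite gt_eqF ?powR_gt0.
have tq1 : t `^ q - 1 != 0.
  by rewrite subr_eq0 powR_eq1 (negPf t1) (negPf q_neq0) orbF -leNgt ltW.
(* up to the factor t^q, this is the denominator t^-q - 1 *)
have tq1' : 1 - t `^ q != 0 by rewrite -opprB oppr_eq0.
by field; rewrite tp0 tq0 tq1 mulN1r tq1'.
Qed.

Lemma balancing_cauchy_power_function :
  balancing_function (cauchy_power_function p q).
Proof.
have cauchy1 : cauchy_power_function p q 1 = 1.
  by rewrite /cauchy_power_function /cauchy_function eqxx.
split=> t t0; have [->|t1] := eqVneq t 1.
- by rewrite cauchy1.
- by rewrite cauchy_power_functionE// powR_ge0.
- by rewrite invr1 cauchy1 mulr1.
- rewrite !cauchy_power_functionE ?invr_eq1 ?invr_ge0 ?(ltW t0)//.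
  rewrite -!mulf_div powR_sub1_divV//.
  have v0 := powR_sub1_div_gt0 t (ltW t0) t1.
  set v := _ / (t `^ q - 1) in v0 *.
  have w0 : 0 <= q / p * v.
    by apply: mulr_ge0; [exact: divr_ge0 (ltW q0) (ltW p0) | exact: ltW].
  rewrite [in RHS]mulrA [in RHS]powRM ?powR_ge0//.
  rewrite -[t `^ _ `^ _]powRrM div1r -[q - p]opprB mulNr divff ?subr_eq0//.
  by rewrite powR_inv1 ?ltW// [RHS]mulrC divfK ?(gt_eqF t0).
Qed.

End CauchyPower.

(** * The Cauchy mean reversiblization *)

Theorem theorem4p1 (R : realType) (X : finType) (mu : X -> R)
    (Hmu : positive_distribution mu) (p q : R) (Hp : 0 < p) (Hq : 0 < q)
    (Hpq : p != q) (L : X -> X -> R) (HL : generator L) :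
  [/\ set_bij [set s : R | 0 < s] [set s : R | 0 < s]
        (derivative_ratio (fun t : R => t `^ p) (fun t : R => t `^ q)),
      forall t : R, 0 <= t -> t != 1 ->
        cauchy_power_function p q t =
        (q * (t `^ p - 1) / (p * (t `^ q - 1))) `^ (1 / (p - q)),
      balancing_function (cauchy_power_function p q) &
      reversible_generator mu (cauchy_reversiblization mu p q L)].
Proof.
have gbal := balancing_cauchy_power_function p q Hp Hq Hpq.
split=> //.
- exact: derivative_ratio_powR_bij.
- exact: cauchy_power_functionE.
- exact: balanced_generator_reversible.
Qed.
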